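(* Let $k\ge1$. Consider a quasi-Newton method with exact linesearch applied to $\min_{x\in\mathbb{R}^n}\frac12x^THx+c^Tx$, where $H=H^T\succ0$, started at $x_0$ with $B_0=I$, symmetric matrices $B_0,\dots,B_{k-1}$, and search directions satisfying $B_ip_i=-g_i$ and $p_i\parallel p_i^{CG}$ for all $i\le k-1$. Assume $g_k\neq0$. Then a symmetric matrix $U_k\in\mathbb{R}^{n\times n}$ satisfies the three conditions (i) $\mathcal{R}(U_k)\subseteq\mathcal{K}_{k+1}(p_0,H)$, (ii) $U_kp_i=0$ for all $i\le k-2$, and (iii) $U_kp_{k-1}=(H-B_{k-1})p_{k-1}$ if and only if $U_k$ belongs to the one-parameter Broyden family, i.e. there is a scalar $\phi_k$ such that, writing $p=p_{k-1}$, $B=B_{k-1}$ and $\varphi=\phi_k\,p^TBp$, $$U_k=\begin{pmatrix}\frac{1}{p^THp}Hp&\frac1{p^TBp}Bp\end{pmatrix}\begin{pmatrix}p^THp+\varphi&-\varphi\\-\varphi&-p^TBp+\varphi\end{pmatrix}\begin{pmatrix}\frac1{p^THp}p^TH\\\frac1{p^TBp}p^TB\end{pmatrix}.$$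
   Context: Problem: minimize $q(x)=\frac12x^THx+c^Tx$ over $\mathbb{R}^n$ with $H=H^T\succ0$; gradient $g(x)=Hx+c$, $g_k=g(x_k)$. All methods use $x_{k+1}=x_k+\alpha_kp_k$ with exact linesearch $\alpha_k=-\frac{p_k^Tg_k}{p_k^THp_k}$. The methods proceed as long as the gradient is nonzero, so $g_0,\dots,g_{k-1}$ are nonzero when iteration $k$ is reached. Quasi-Newton method: $p_k$ is obtained as a solution of $B_kp_k=-g_k$ with $B_k$ symmetric. Conjugate gradient method (CG): started at the same $x_0$ with exact linesearch, it uses the directions $p_0^{CG}=-g_0$ and $p_k^{CG}=-g_k+\beta_{k-1}p_{k-1}^{CG}$, $\beta_{k-1}=\frac{(p_{k-1}^{CG})^THg_k}{(p_{k-1}^{CG})^THp_{k-1}^{CG}}$ for $k\geq 1$, where here $g_k$ is the gradient at the $k$-th CG iterate. Notation: $p\parallel p'$ means $p=\delta p'$ for some nonzero scalar $\delta$. $\mathcal{K}_k(b,A)=\mathrm{span}\{b,Ab,\dots,A^{k-1}b\}$ is the Krylov subspace (with $\mathcal{K}_0=\{0\}$). $\mathcal{R}(M)$ is the range space of the matrix $M$. *)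

(* Defs.v *)
From HB Require Import structures.
From mathcomp Require Import all_boot all_order all_algebra.
From mathcomp Require Import reals.

Set Implicit Arguments.
Unset Strict Implicit.
Unset Printing Implicit Defensive.

Import Order.TTheory GRing.Theory Num.Theory.
Local Open Scope ring_scope.

Definition dot (R : realType) (n : nat) (u v : 'cV[R]_n) : R :=
  (u^T *m v) 0 0.

Definition symmetric_mx (R : realType) (n : nat) (A : 'M[R]_n) : Prop :=
  A^T = A.

Definition posdef_mx (R : realType) (n : nat) (A : 'M[R]_n) : Prop :=
  forall v : 'cV[R]_n, v != 0 -> 0 < dot v (A *m v).

(* Gradient of the quadratic objective x |-> (1/2) x^T H x + c^T x. *)
Definition grad (R : realType) (n : nat) (H : 'M[R]_n) (c x : 'cV[R]_n) :
  'cV[R]_n := H *m x + c.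

Definition exact_step (R : realType) (n : nat) (H : 'M[R]_n)
    (g p : 'cV[R]_n) : R :=
  - (dot p g / dot p (H *m p)).

Definition next_iterate (R : realType) (n : nat) (H : 'M[R]_n)
    (c x p : 'cV[R]_n) : 'cV[R]_n :=
  x + exact_step H (grad H c x) p *: p.

(* The pair (x_i, p_i) of conjugate gradient iterates and directions.  The
   recursion is total: once a gradient vanishes, all later directions are 0
   (division by 0 yields 0), so the iterates stay at the minimizer. *)
Fixpoint cg (R : realType) (n : nat) (H : 'M[R]_n) (c x0 : 'cV[R]_n)
    (i : nat) : 'cV[R]_n * 'cV[R]_n :=
  if i is j.+1 then
    let x := (cg H c x0 j).1 in
    let p := (cg H c x0 j).2 in
    let x' := next_iterate H c x p in
    let g' := grad H c x' in
    let beta := dot p (H *m g') / dot p (H *m p) in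
    (x', - g' + beta *: p)
  else (x0, - grad H c x0).

Definition cg_dir (R : realType) (n : nat) (H : 'M[R]_n) (c x0 : 'cV[R]_n)
    (i : nat) : 'cV[R]_n := (cg H c x0 i).2.

Definition parallel (R : realType) (n : nat) (p p' : 'cV[R]_n) : Prop :=
  exists2 delta : R, delta != 0 & p = delta *: p'.

(* Iterations 0, ..., k-1 have been carried out from x0, producing the iterates
   x 0, ..., x k; an iteration is only performed at a nonzero gradient.  The
   values of p and B from index k on, and of x after k, are irrelevant. *)
Record quasi_newton_run (R : realType) (n : nat) (H : 'M[R]_n)
    (c x0 : 'cV[R]_n) (k : nat) (x p : nat -> 'cV[R]_n) (B : nat -> 'M[R]_n) :
    Prop := QuasiNewtonRun {
  qn_start : x 0%N = x0;
  qn_gradient_neq0 : forall i, (i < k)%N -> grad H c (x i) != 0;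
  qn_symmetric : forall i, (i < k)%N -> symmetric_mx (B i);
  qn_direction : forall i, (i < k)%N -> B i *m p i = - grad H c (x i);
  qn_step : forall i, (i < k)%N -> x i.+1 = next_iterate H c (x i) (p i)
}.

Definition krylov (R : realType) (n : nat) (m : nat) (b : 'cV[R]_n)
    (A : 'M[R]_n) : {vspace 'cV[R]_n} :=
  <<mkseq (fun i => A ^+ i *m b) m>>%VS.

Definition range_mx (R : realType) (n : nat) (A : 'M[R]_n) :
  {vspace 'cV[R]_n} := limg (linfun (mulmx A : 'cV[R]_n -> 'cV[R]_n)).

Definition broyden_update (R : realType) (n : nat) (H B : 'M[R]_n)
    (p : 'cV[R]_n) (phi : R) : 'M[R]_n :=
  let pHp := dot p (H *m p) in
  let pBp := dot p (B *m p) in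
  let vphi := phi * pBp in
  row_mx (pHp^-1 *: (H *m p)) (pBp^-1 *: (B *m p))
  *m block_mx (pHp + vphi)%:M (- vphi)%:M
              (- vphi)%:M     (- pBp + vphi)%:M
  *m col_mx (pHp^-1 *: (p^T *m H)) (pBp^-1 *: (p^T *m B)).

(* Main.v *)
(* Parallel directions and exact linesearch give the CG iterates, so the
   gradients g_i are mutually orthogonal, the p_i are H-conjugate, and
   K_{k+1}(p_0, H) = span(g_0, ..., g_k).  Hence the orthogonal complement of
   p_0, ..., p_{k-1} in K_{k+1} is the line spanned by g_k.
   Write p = p_{k-1} and B = B_{k-1}.  Since B p = -g_{k-1} and
   g_k = g_{k-1} + (p^T B p / p^T H p) H p, the vector multiplying the free
   parameter of the Broyden family satisfies
     H p / p^T H p - B p / p^T B p = g_k / p^T B p,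
   so the members of the family differ exactly by multiples of g_k g_k^T.
   Every member satisfies (i)-(iii).  Conversely, if U satisfies (i)-(iii), its
   difference D with the member phi = 0 is symmetric, has range in K_{k+1} and
   kills p_0, ..., p_{k-1}; by symmetry its range is then orthogonal to these
   p_i, hence contained in the line spanned by g_k, and D is a multiple of
   g_k g_k^T. *)
Require Import Defs.
From HB Require Import structures.
From mathcomp Require Import all_boot all_order all_algebra.
From mathcomp Require Import reals.
From mathcomp Require Import ring.

Set Implicit Arguments.
Unset Strict Implicit.
Unset Printing Implicit Defensive.

Import Order.TTheory GRing.Theory Num.Theory.
Local Open Scope ring_scope.

(** * Dot products, spans, and symmetric matrices with range in a line *)

Section DotProduct.
Variables (R : realType) (n : nat).
Implicit Types (u v w : 'cV[R]_n) (A : 'M[R]_n) (X : seq 'cV[R]_n).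

Lemma dotE u v : dot u v = \sum_i u i 0 * v i 0.
Proof. by rewrite /dot mxE; apply: eq_bigr => i _; rewrite mxE. Qed.

Lemma dotC u v : dot u v = dot v u.
Proof. by rewrite !dotE; apply: eq_bigr => i _; rewrite mulrC. Qed.

Lemma dotDr u v w : dot u (v + w) = dot u v + dot u w.
Proof. by rewrite /dot mulmxDr mxE. Qed.

Lemma dotZr a u v : dot u (a *: v) = a * dot u v.
Proof. by rewrite /dot -scalemxAr mxE. Qed.

Lemma dotNr u v : dot u (- v) = - dot u v.
Proof. by rewrite /dot mulmxN mxE. Qed.

Lemma dotDl u v w : dot (v + w) u = dot v u + dot w u.
Proof. by rewrite dotC dotDr !(dotC u). Qed.

Lemma dotZl a u v : dot (a *: v) u = a * dot v u.
Proof. by rewrite dotC dotZr dotC. Qed.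

Lemma dotNl u v : dot (- v) u = - dot v u.
Proof. by rewrite dotC dotNr dotC. Qed.

Lemma dot0l v : dot 0 v = 0.
Proof. by rewrite -(scale0r 0) dotZl mul0r. Qed.

Lemma dot_sumr u (I : finType) (F : I -> 'cV[R]_n) :
  dot u (\sum_i F i) = \sum_i dot u (F i).
Proof. by rewrite /dot mulmx_sumr summxE. Qed.

Lemma dot_eq0 v : (dot v v == 0) = (v == 0).
Proof.
apply/idP/eqP => [|->]; last by rewrite dot0l.
rewrite dotE psumr_eq0 => [|i _]; last by rewrite -expr2 sqr_ge0.
move=> /allP v0; apply/colP => i; rewrite mxE; apply/eqP.
by have := v0 i (mem_index_enum i); rewrite /= mulf_eq0 orbb.
Qed.

Lemma dot_mulmx_sym A u v : A^T = A -> dot (A *m u) v = dot u (A *m v).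
Proof. by move=> As; rewrite /dot trmx_mul As mulmxA. Qed.

Lemma mulmx_outer v w u : v *m w^T *m u = dot w u *: v.
Proof. by rewrite -mulmxA [w^T *m u]mx11_scalar mul_mx_scalar. Qed.

Lemma mulmx_col_ext (A A' : 'M[R]_n) :
  (forall u : 'cV[R]_n, A *m u = A' *m u) -> A = A'.
Proof.
move=> eqA; apply/matrixP => i j.
by have /colP /(_ i) := eqA (delta_mx j 0); rewrite -!colE !mxE.
Qed.

Lemma mulmx_span A X v (W : {vspace 'cV[R]_n}) :
  (forall u, u \in X -> A *m u \in W) -> v \in <<X>>%VS -> A *m v \in W.
Proof.
move=> AXW /(coord_span (X := in_tuple X)) ->.
rewrite mulmx_sumr rpred_sum // => i _.
by rewrite -scalemxAr rpredZ // AXW // mem_nth.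
Qed.

Lemma dot_span X v w :
  (forall u, u \in X -> dot w u = 0) -> v \in <<X>>%VS -> dot w v = 0.
Proof.
move=> wX /(coord_span (X := in_tuple X)) ->.
rewrite dot_sumr big1 // => i _.
by rewrite dotZr wX ?mulr0 // mem_nth.
Qed.

Lemma range_mx_subP A (W : {vspace 'cV[R]_n}) :
  (range_mx A <= W)%VS <-> (forall u : 'cV[R]_n, A *m u \in W).
Proof.
split=> [/subvP sAW u | AW].
  apply: sAW; have -> : A *m u = linfun (mulmx A : 'cV[R]_n -> 'cV[R]_n) u.
    by rewrite lfunE.
  by rewrite memv_img ?memvf.
by apply/subvP => _ /memv_imgP [u _ ->]; rewrite lfunE /= AW.
Qed.

Lemma mem_mkseq_span (f : nat -> 'cV[R]_n) i m :
  (i < m)%N -> f i \in <<mkseq f m>>%VS.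
Proof. by move=> im; apply: memv_span; apply: map_f; rewrite mem_iota. Qed.

Lemma mkseq_spanS (f : nat -> 'cV[R]_n) m m' :
  (m <= m')%N -> (<<mkseq f m>> <= <<mkseq f m'>>)%VS.
Proof.
move=> mm'; apply/span_subvP => _ /mapP [i + ->].
by rewrite mem_iota => /leq_trans im; apply: mem_mkseq_span; apply: im.
Qed.

(** If [A *m u = b *: v], pairing with [v] and moving [A] across by symmetry gives
    [b * dot v v = a * dot v u], where [a] is the eigenvalue of [A] at [v]. *)
Lemma symmetric_rank1 A v : A^T = A -> v != 0 ->
  (forall u : 'cV[R]_n, exists a, A *m u = a *: v) ->
  exists a, A = a *: (v *m v^T).
Proof.
move=> As v0 Av; have vv : dot v v != 0 by rewrite dot_eq0.
have [a Avv] := Av v; exists (a / dot v v).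
apply: mulmx_col_ext => u; have [b Au] := Av u.
rewrite -scalemxAl mulmx_outer scalerA Au; congr (_ *: _).
apply: (mulIf vv); rewrite mulrAC divfK // -!dotZl -Avv -Au.
by rewrite dotC -dot_mulmx_sym.
Qed.

End DotProduct.

(** * Conjugate gradients: orthogonality, conjugacy and Krylov subspaces *)

Section ConjugateGradient.
Variables (R : realType) (n : nat) (H : 'M[R]_n) (c x0 : 'cV[R]_n).
Hypotheses (H_sym : symmetric_mx H) (H_pd : posdef_mx H).

Let g i := grad H c (cg H c x0 i).1.
Let d i := cg_dir H c x0 i.
Let alpha i := exact_step H (g i) (d i).

Lemma grad_next_iterate y v :
  grad H c (next_iterate H c y v) =
  grad H c y + exact_step H (grad H c y) v *: (H *m v).
Proof. by rewrite /grad mulmxDr -scalemxAr addrAC. Qed.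

Lemma cg_gradS i : g i.+1 = g i + alpha i *: (H *m d i).
Proof. exact: grad_next_iterate. Qed.

Lemma cg_dirS i :
  d i.+1 = - g i.+1 + dot (d i) (H *m g i.+1) / dot (d i) (H *m d i) *: d i.
Proof. by []. Qed.

Lemma dot_H_eq0 v : (dot v (H *m v) == 0) = (v == 0).
Proof.
have [->|v0] := eqVneq v 0; first by rewrite dot0l eqxx.
by rewrite gt_eqF // H_pd.
Qed.

(** Exact linesearch along [v] from a point with gradient [y] makes the new gradient orthogonal to
    [v]. For [v = 0] both terms vanish. *)
Lemma dot_exact_step y v :
  dot v y + exact_step H y v * dot v (H *m v) = 0.
Proof.
have [->|v0] := eqVneq v 0; first by rewrite !dot0l mulr0 addr0.
by rewrite /exact_step mulNr divfK ?dot_H_eq0 // subrr.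
Qed.

Lemma cg_grad_span (W : {vspace 'cV[R]_n}) i :
  (forall j, (j <= i)%N -> d j \in W) -> g i \in W.
Proof.
case: i => [|i] dW.
  by rewrite -[g 0]opprK memvN; apply: (dW 0%N).
rewrite -[g _]opprK memvN.
have -> : - g i.+1 = d i.+1 -
    dot (d i) (H *m g i.+1) / dot (d i) (H *m d i) *: d i.
  by rewrite cg_dirS addrK.
by rewrite memvB ?memvZ ?dW.
Qed.

Lemma cg_dot_grad v i :
  (forall j, (j <= i)%N -> dot v (d j) = 0) -> dot v (g i) = 0.
Proof.
move=> vd; apply: (@dot_span _ _ (mkseq d i.+1)).
  by move=> _ /mapP [j + ->]; rewrite mem_iota => /vd.
by apply: cg_grad_span => j ji; apply: mem_mkseq_span.
Qed.

Lemma cg_dot_dir_grad i :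
  (forall j, (j < i)%N -> dot (g i) (d j) = 0) ->
  dot (d i) (g i) = - dot (g i) (g i).
Proof.
case: i => [|i] gd; first by rewrite dotNl.
by rewrite cg_dirS dotDl dotNl dotZl [dot (d i) (g _)]dotC gd // mulr0 addr0.
Qed.

(** A zero step would force [dot (d i) (g i) = 0], whereas this product is [- dot (g i) (g i)].
    Nonzero steps allow [H *m d i] to be recovered from a difference of gradients. *)
Lemma alpha_neq0 i : g i != 0 ->
  (forall j, (j < i)%N -> dot (g i) (d j) = 0) -> alpha i != 0.
Proof.
move=> gi gd; apply/eqP => a0; have := dot_exact_step (g i) (d i).
rewrite -/(alpha i) a0 mul0r addr0 cg_dot_dir_grad // => /eqP.
by rewrite oppr_eq0 dot_eq0 (negPf gi).
Qed.

(** Both claims go through one strong induction: orthogonality at [m.+1] uses conjugacy at [m], and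
    conjugacy at [m.+1] uses orthogonality up to [m.+1]. The gradient [g m] itself may vanish. *)
Lemma cg_orthogonality m :
  (forall i, (i < m)%N -> g i != 0) ->
  (forall j, (j < m)%N -> dot (g m) (d j) = 0) /\
  (forall j, (j < m)%N -> dot (d m) (H *m d j) = 0).
Proof.
elim/ltn_ind: m => -[//|m] IH gN.
have gdl i : (i <= m)%N -> forall j, (j < i)%N -> dot (g i) (d j) = 0.
  move=> im; apply: (IH i im _).1 => l li; apply: gN.
  by rewrite ltnS ltnW // (leq_trans li).
have [_ dHd] := IH m (leqnn _) (fun i im => gN i (ltnW im)).
have gd j : (j < m.+1)%N -> dot (g m.+1) (d j) = 0.
  rewrite ltnS leq_eqVlt cg_gradS dotDl dotZl => /predU1P [->|jm].
    rewrite [dot (g m) _]dotC dot_mulmx_sym //; exact: dot_exact_step.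
  by rewrite gdl // dot_mulmx_sym // dHd // mulr0 addr0.
split=> // j.
rewrite ltnS leq_eqVlt cg_dirS dotDl dotNl dotZl => /predU1P [->|jm].
  rewrite -dot_mulmx_sym // [dot (H *m _) _]dotC.
  (* The coefficient of [d m] in [d m.+1] is chosen to cancel this product. *)
  have [->|dm0] := eqVneq (d m) 0.
    by rewrite !dot0l mul0r oppr0 mul0r addr0.
  by rewrite divfK ?dot_H_eq0 // addNr.
rewrite (dHd j) // mulr0 addr0; apply/eqP; rewrite oppr_eq0.
have aj : alpha j != 0.
  by apply: alpha_neq0; [apply: gN; apply: ltnW | apply: gdl; apply: ltnW].
(* After scaling by [alpha j], the vector [H *m d j] becomes a difference of gradients. Since
   [j < m], both lie in the span of [d 0], ..., [d m], to which [g m.+1] is orthogonal. *)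
rewrite -(mulrI_eq0 _ (mulfI aj)) -dotZr.
have -> : alpha j *: (H *m d j) = g j.+1 - g j by rewrite cg_gradS addrC addKr.
rewrite dotDr dotNr !cg_dot_grad ?subrr // => i ij; apply: gd.
  exact: leq_ltn_trans ij (ltnW _).
exact: leq_ltn_trans ij _.
Qed.

Lemma krylovS m m' b :
  (m <= m')%N -> (krylov m b H <= krylov m' b H)%VS.
Proof. exact: mkseq_spanS. Qed.

Lemma mulmx_krylov m b v :
  v \in krylov m b H -> H *m v \in krylov m.+1 b H.
Proof.
apply: mulmx_span => _ /mapP [i + ->]; rewrite mem_iota => im.
rewrite mulmxA -[H *m _]/(H * _) -exprS.
exact: (mem_mkseq_span (fun i => H ^+ i *m b)).
Qed.

Lemma cg_mem_krylov m :
  g m \in krylov m.+1 (d 0%N) H /\ d m \in krylov m.+1 (d 0%N) H.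
Proof.
elim: m => [|m [gm dm]].
  have d0 : d 0%N \in krylov 1 (d 0%N) H.
    by rewrite memv_span // mem_seq1 expr0 mul1mx.
  by split=> //; rewrite -[g 0]opprK memvN.
have gS : g m.+1 \in krylov m.+2 (d 0%N) H.
  rewrite cg_gradS memvD ?memvZ ?mulmx_krylov //.
  exact: (subvP (krylovS _ (leqnSn _))).
split=> //; rewrite cg_dirS memvD ?memvN // memvZ //.
exact: (subvP (krylovS _ (leqnSn _))).
Qed.

Lemma cg_dir_mem_grad_span m : d m \in <<mkseq g m.+1>>%VS.
Proof.
elim: m => [|m IH]; first by rewrite (_ : d 0 = - g 0) // memvN mem_mkseq_span.
rewrite cg_dirS memvD ?memvN ?mem_mkseq_span // memvZ //.
exact: (subvP (mkseq_spanS g (leqnSn _))).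
Qed.

(** The step [HG] shows that [H] raises the gradient span by one index: earlier gradients are
    combinations of directions [d l], and [H *m d l] is a multiple of [g l.+1 - g l]. Induction on
    the power of [H] follows. *)
Lemma krylov_sub_grad_span m : (forall i, (i < m)%N -> g i != 0) ->
  (krylov m.+1 (d 0%N) H <= <<mkseq g m.+1>>)%VS.
Proof.
move=> gN; have HG i v : (i <= m)%N -> v \in <<mkseq g i>>%VS ->
    H *m v \in <<mkseq g i.+1>>%VS.
  move=> im; apply: mulmx_span => _ /mapP [j + ->].
  rewrite mem_iota /= add0n => ji.
  have gd : g j \in <<mkseq d i>>%VS.
    by apply: cg_grad_span => l lj; apply: mem_mkseq_span; apply: leq_ltn_trans ji.
  apply: mulmx_span gd => _ /mapP [l + ->]; rewrite mem_iota /= add0n => li.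
  have lm := leq_trans li im.
  have al : alpha l != 0.
    apply: alpha_neq0; first exact: gN.
    by apply: (cg_orthogonality _).1 => r rl; apply: gN; apply: ltn_trans lm.
  rewrite -[H *m _]scale1r -(mulVf al) -scalerA memvZ //.
  have -> : alpha l *: (H *m d l) = g l.+1 - g l by rewrite cg_gradS addrC addKr.
  by rewrite memvB // mem_mkseq_span // ltnS // ltnW.
apply/span_subvP => _ /mapP [i + ->]; rewrite mem_iota /= add0n ltnS => im.
apply: (subvP (mkseq_spanS g (im : (i.+1 <= m.+1)%N))).
elim: i im => [|i IH] im; first by rewrite expr0 mul1mx cg_dir_mem_grad_span.
by rewrite exprS -mulmxA HG // IH // ltnW.
Qed.

(** Split [v = u + a *: g m] with [u] in the span of the earlier gradients. Both [v] and [g m] are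
    orthogonal to that span, so [dot u u = 0]. *)
Lemma krylov_orthogonal_dir m v : (forall i, (i < m)%N -> g i != 0) ->
  v \in krylov m.+1 (d 0%N) H -> (forall i, (i < m)%N -> dot v (d i) = 0) ->
  exists a, v = a *: g m.
Proof.
move=> gN /(subvP (krylov_sub_grad_span gN)) + vd.
rewrite mkseqS -cats1 span_cat span_seq1.
move=> /memv_addP [u uG [_ /vlineP [a ->] vE]]; exists a.
have [gd _] := cg_orthogonality gN.
have orth w : (forall i, (i < m)%N -> dot w (d i) = 0) -> dot w u = 0.
  move=> wd; apply: dot_span uG => _ /mapP [i + ->]; rewrite mem_iota => im.
  by apply: cg_dot_grad => j ji; apply: wd; apply: leq_ltn_trans im.
suff /eqP u0 : u == 0 by rewrite vE u0 add0r.
rewrite -dot_eq0; have {1}-> : u = v - a *: g m by rewrite vE addrK.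
by rewrite dotDl dotNl dotZl !orth // mulr0 subr0.
Qed.

End ConjugateGradient.

(** * Broyden matrices, and quasi-Newton iterates as CG iterates *)

Section QuasiNewton.
Variables (R : realType) (n : nat).
Implicit Types (H B : 'M[R]_n) (c x p : 'cV[R]_n).

(** Isolates [phi] as the coefficient of a single rank-one matrix. *)
Lemma broyden_updateE H B p phi : H^T = H -> B^T = B ->
  dot p (H *m p) != 0 -> dot p (B *m p) != 0 ->
  let w := (dot p (H *m p))^-1 *: (H *m p) - (dot p (B *m p))^-1 *: (B *m p) in
  broyden_update H B p phi =
  (dot p (H *m p))^-1 *: (H *m p *m (H *m p)^T)
  - (dot p (B *m p))^-1 *: (B *m p *m (B *m p)^T)
  + (phi * dot p (B *m p)) *: (w *m w^T).
Proof.
move=> Hs Bs; rewrite /broyden_update.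
have -> : p^T *m H = (H *m p)^T by rewrite trmx_mul Hs.
have -> : p^T *m B = (B *m p)^T by rewrite trmx_mul Bs.
move: (dot p (H *m p)) (dot p (B *m p)) => a b.
move: (H *m p) (B *m p) => u v a0 b0 /=.
rewrite mul_row_block mul_row_col !mul_mx_scalar.
by apply/matrixP => i j; rewrite !(mxE, big_ord1); field; rewrite a0 b0.
Qed.

(** The exact step length scales by the inverse of [a], so only the line matters. *)
Lemma next_iterate_scale H c x p a : a != 0 ->
  next_iterate H c x (a *: p) = next_iterate H c x p.
Proof.
move=> a0; rewrite /next_iterate /exact_step -scalemxAr !(dotZl, dotZr).
rewrite scalerA; congr (_ + _ *: _).
by rewrite -mulf_div divff // mul1r invfM mulrA mulNr mulrAC divfK.
Qed.

Lemma quasi_newton_cg H c x0 k (x p : nat -> 'cV[R]_n) (B : nat -> 'M[R]_n) :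
  quasi_newton_run H c x0 k x p B ->
  (forall i, (i < k)%N -> parallel (p i) (cg_dir H c x0 i)) ->
  forall i, (i <= k)%N -> x i = (cg H c x0 i).1.
Proof.
move=> [x_0 _ _ _ xS] p_cg; elim=> [//|i IH] ik.
have [a a0 pE] := p_cg i ik.
by rewrite xS // pE next_iterate_scale // IH // ltnW.
Qed.

End QuasiNewton.

Theorem theorem3p6 (R : realType) (n k : nat) (hk : (1 <= k)%N)
  (H : 'M[R]_n) (c x0 : 'cV[R]_n)
  (H_sym : symmetric_mx H) (H_pd : posdef_mx H)
  (x p : nat -> 'cV[R]_n) (B : nat -> 'M[R]_n)
  (qn : quasi_newton_run H c x0 k x p B)
  (B0 : B 0%N = 1%:M)
  (p_cg : forall i : nat, (i <= k.-1)%N -> parallel (p i) (cg_dir H c x0 i))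
  (gk_neq0 : grad H c (x k) != 0)
  (U : 'M[R]_n) (U_sym : symmetric_mx U) :
  [/\ (range_mx U <= krylov k.+1 (p 0%N) H)%VS,
      (forall i : nat, (i + 2 <= k)%N -> U *m p i = 0)
    & U *m p k.-1 = (H - B k.-1) *m p k.-1]
  <->
  (exists phi : R, U = broyden_update H (B k.-1) (p k.-1) phi).
Proof.
case: k hk qn p_cg gk_neq0 => // m _ qn p_cg gm_neq0 /=.
have p_par i : (i < m.+1)%N -> parallel (p i) (cg_dir H c x0 i) by apply: p_cg.
have xE := quasi_newton_cg qn p_par.
pose g i := grad H c (cg H c x0 i).1.
have gE i : (i <= m.+1)%N -> grad H c (x i) = g i by move=> /xE ->.
have [_ gN Bsym BpE xS] := qn.
have gN' i : (i < m.+1)%N -> g i != 0 by move=> im; rewrite -gE ?gN // ltnW.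
have gk0 : g m.+1 != 0 by rewrite -gE.
have Bs := Bsym m (ltnSn m).
have Bp : B m *m p m = - g m by rewrite BpE // gE.
have [gSd _] := cg_orthogonality H_sym H_pd gN'.
have [gd dHd] := cg_orthogonality H_sym H_pd (fun i im => gN' i (ltnW im)).
have gSp i : (i < m.+1)%N -> dot (g m.+1) (p i) = 0.
  by move=> im; have [e _ ->] := p_par i im; rewrite dotZr gSd // mulr0.
have gp i : (i < m)%N -> dot (g m) (p i) = 0.
  by move=> im; have [e _ ->] := p_par i (ltnW im); rewrite dotZr gd // mulr0.
have [e e0 pE] := p_par m (ltnSn m).
have pHp i : (i < m)%N -> dot (H *m p m) (p i) = 0.
  move=> im; have [e' _ ->] := p_par i (ltnW im).
  by rewrite dot_mulmx_sym // pE dotZl -scalemxAr dotZr dHd // !mulr0.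
have pg : dot (p m) (g m) = - (e * dot (g m) (g m)).
  by rewrite pE dotZl cg_dot_dir_grad // mulrN.
(* Since [B m *m p m = - g m], this number is [e * dot (g m) (g m)]. *)
have b_neq0 : dot (p m) (B m *m p m) != 0.
  by rewrite Bp dotNr pg opprK mulf_neq0 // dot_eq0 gN'.
have a_neq0 : dot (p m) (H *m p m) != 0.
  by rewrite dot_H_eq0 //; apply: contraNneq b_neq0 => ->; rewrite dot0l.
have gSE : g m.+1 =
    g m + (dot (p m) (B m *m p m) / dot (p m) (H *m p m)) *: (H *m p m).
  rewrite -!gE // xS // grad_next_iterate /exact_step gE // Bp dotNr.
  by rewrite mulNr.
set a := dot (p m) (H *m p m) in a_neq0 gSE.
set b := dot (p m) (B m *m p m) in b_neq0 gSE.
(* The vector [w] of [broyden_updateE] is [b^-1 *: g m.+1], which turns the coefficient [phi * b]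
   into [phi / b]. *)
have broydenE phi : broyden_update H (B m) (p m) phi =
    a^-1 *: (H *m p m *m (H *m p m)^T) - b^-1 *: (g m *m (g m)^T)
    + (phi / b) *: (g m.+1 *m (g m.+1)^T).
  rewrite broyden_updateE // -/a -/b.
  have -> : a^-1 *: (H *m p m) - b^-1 *: (B m *m p m) = b^-1 *: g m.+1.
    by rewrite gSE Bp scalerDr scalerA mulKf // scalerN opprK addrC.
  rewrite Bp linearN mulmxN mulNmx opprK; congr (_ + _).
  rewrite linearZ /= -scalemxAl -scalemxAr !scalerA; congr (_ *: _).
  by field.
have broyden_mul phi u : broyden_update H (B m) (p m) phi *m u =
    (a^-1 * dot (H *m p m) u) *: (H *m p m) - (b^-1 * dot (g m) u) *: g m
    + (phi / b * dot (g m.+1) u) *: g m.+1.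
  by rewrite broydenE 2!mulmxDl mulNmx -!scalemxAl !mulmx_outer !scalerA.
have broyden_sym phi : (broyden_update H (B m) (p m) phi)^T =
    broyden_update H (B m) (p m) phi.
  by rewrite broydenE 2!linearD linearN !linearZ /= !trmx_mul !trmxK.
have broyden_prev phi i : (i < m)%N ->
    broyden_update H (B m) (p m) phi *m p i = 0.
  move=> im; rewrite broyden_mul pHp // gp // gSp; last exact: ltnW.
  by rewrite !mulr0 !scale0r subr0 addr0.
have broyden_last phi :
    broyden_update H (B m) (p m) phi *m p m = (H - B m) *m p m.
  rewrite broyden_mul gSp // mulr0 scale0r addr0 dot_mulmx_sym // -/a mulVf //.
  rewrite scale1r mulmxBl Bp; congr (_ - _).
  have -> : dot (g m) (p m) = - b by rewrite dotC /b Bp dotNr opprK.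
  by rewrite mulrN mulVf // scaleN1r.
(* The choice [B 0 = 1] makes the first directions equal, not merely parallel, so the Krylov
   subspaces coincide literally. *)
have p0E : p 0%N = cg_dir H c x0 0.
  by have := BpE 0%N (ltn0Sn m); rewrite B0 mul1mx => ->; rewrite gE.
have gK i : (i <= m.+1)%N -> g i \in krylov m.+2 (p 0%N) H.
  move=> im; rewrite p0E.
  have [+ _] := cg_mem_krylov H c x0 i; exact/subvP/krylovS.
have HpK : H *m p m \in krylov m.+2 (p 0%N) H.
  rewrite pE -scalemxAr memvZ // mulmx_krylov // p0E.
  by have [] := cg_mem_krylov H c x0 m.
have broydenK phi u :
    broyden_update H (B m) (p m) phi *m u \in krylov m.+2 (p 0%N) H.
  by rewrite broyden_mul memvD ?memvB ?memvZ ?gK.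
split=> [[/range_mx_subP UK Uprev Ulast] | [phi ->]]; last first.
  split=> //; first by apply/range_mx_subP.
  by move=> i; rewrite addn2 ltnS => im; apply: broyden_prev.
pose D := U - broyden_update H (B m) (p m) 0.
have Ds : D^T = D by rewrite linearB /= broyden_sym U_sym.
have Dp i : (i < m.+1)%N -> D *m p i = 0.
  rewrite ltnS leq_eqVlt mulmxBl => /predU1P [->|im].
    by rewrite Ulast broyden_last subrr.
  by rewrite Uprev ?broyden_prev ?subrr // addn2.
have [s DE] : exists s, D = s *: (g m.+1 *m (g m.+1)^T).
  apply: symmetric_rank1 => // u; apply: krylov_orthogonal_dir => //.
    by rewrite -p0E mulmxBl memvB ?UK.
  move=> i im; have [e' e'0 piE] := p_par i im.
  apply: (mulfI e'0); rewrite mulr0 -dotZr -piE dot_mulmx_sym //.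
  by rewrite Dp // dotC dot0l.
(* The parameter solves [phi / b = s], the coefficient found in [DE]. *)
exists (s * b); rewrite -[U](subrK (broyden_update H (B m) (p m) 0)) -/D DE.
by rewrite !broydenE mul0r scale0r addr0 mulfK // addrC.
Qed.
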